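(* Let $m\ge 1$ and $n\ge 1$ be integers, let $X=A_m$ and let $Y=A_{2n-1}^{(1)}$, and let $Q=X\square Y$ be their box product quiver, with the variables $x_v$ ($v$ a vertex of $Q$) as initial cluster variables. Let $\mu=\mu_-\mu_+$ be the associated bipartite mutation map, acting as a field automorphism of $\mathbb F=\mathbb C(x_v : v\in Q)$. Then $\mu$ is linearizable at every initial cluster variable $x_v$; in other words, the quiver $A_m\square A_{2n-1}^{(1)}$ is Zamolodchikov integrable.
   Context: Quivers and mutation. A quiver is a directed graph without loops or directed 2-cycles; multiple arrows are allowed. For a vertex $z$, mutation $\mu_z$ changes the quiver as follows. For each pair of arrows $y\to z$, $z\to y'$ an arrow $y\to y'$ is added. Then all arrows at $z$ are reversed. Then directed 2-cycles are removed pair by pair until none remain. Each vertex carries a variable, denoted by the same letter. Under $\mu_z$ only the variable at $z$ changes, to $z'$ with $zz'=\prod_{y\to z}y+\prod_{z\to y}y$, where the products run over arrows into and out of $z$, counted with multiplicity. Mutations at two vertices not joined by an arrow commute. Box product. Let $Q=Q_0\sqcup Q_1$ and $Q'=Q_0'\sqcup Q_1'$ be graphs, possibly with multiple edges, whose edges all go between the two parts. The box product $Q\square Q'$ has vertex set $Q\times Q'$. For each edge $q_1'q_2'$ of $Q'$ and each $q\in Q$ there is an edge between $(q,q_1')$ and $(q,q_2')$. For each edge $q_1q_2$ of $Q$ and each $q'\in Q'$ there is an edge between $(q_1,q')$ and $(q_2,q')$. These edges are oriented from $Q_0\times Q_0'$ to $Q_1\times Q_0'$, from $Q_1\times Q_0'$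 to $Q_1\times Q_1'$, from $Q_1\times Q_1'$ to $Q_0\times Q_1'$, and from $Q_0\times Q_1'$ to $Q_0\times Q_0'$. The two factors. $A_m$ is the path with $m$ vertices, bipartitioned by alternating along the path. $A_{2n-1}^{(1)}$ is the cycle with $2n$ vertices, bipartitioned by alternating around the cycle; for $n=1$ it is two vertices joined by a double edge. The map $\mu$. Vertices in $Q_0\times Q_0'$ and $Q_1\times Q_1'$ are black; the others are white. $\mu_+$ is the composition of the mutations at all black vertices and $\mu_-$ is the composition of the mutations at all white vertices. $\mu_+$ (resp. $\mu_-$) turns $Q\square Q'$ into the same quiver with all arrows reversed, so $\mu_-\mu_+$ (first $\mu_+$, then $\mu_-$) returns the original quiver. Starting from initial variables $x_v$ (independent indeterminates), it therefore defines a field automorphism $\mu$ of $\mathbb F$: $\mu(x_v)$ is the variable at $v$ after applying $\mu_-\mu_+$. Linearizability. A sequence $(a_k)_{k\in\mathbb Z}$ in a field is linearizable of order $r$ if there are constants $c_1,\dots,c_r$ in the field, independent of $k$, with $a_k=c_1a_{k-1}+\dots+c_ra_{k-r}$ for all $k\in\mathbb Z$. It is linearizable if it is linearizable of some order. $\mu$ is linearizable at $x\in\mathbb F$ if $(\mu^k(x))_{k\in\mathbb Z}$ is linearizable. *)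

(* Defs.v *)
From HB Require Import structures.
From mathcomp Require Import all_boot all_order all_algebra.
From mathcomp Require Import fraction reals complex mpoly zify.

Set Implicit Arguments.
Unset Strict Implicit.
Unset Printing Implicit Defensive.

Import GRing.Theory.
Local Open Scope ring_scope.

Section Seeds.
Variables (V : finType) (F : fieldType).

(* [q u w] is the number of arrows u -> w.  Quivers have no loops and no
   directed 2-cycles; [mutate_quiver] keeps this property. *)
Definition arrows := V -> V -> nat.

Definition is_quiver (q : arrows) : Prop :=
  (forall u, q u u = 0%N) /\ (forall u w, q u w = 0%N \/ q w u = 0%N).

(* The number of arrows u -> w after the first step of the mutation at z, for
   u and w different from z; the truncated subtraction in [mutate_quiver] is
   the removal of 2-cycles, pair by pair. *)
Definition compose_arrows (z : V) (q : arrows) : arrows :=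
  fun u w => (q u w + q u z * q z w)%N.

Definition mutate_quiver (z : V) (q : arrows) : arrows :=
  fun u w =>
    if (u == z) || (w == z) then q w u
    else (compose_arrows z q u w - compose_arrows z q w u)%N.

Lemma mutate_is_quiver z q : is_quiver q -> is_quiver (mutate_quiver z q).
Proof.
case=> h0 h2; split=> [u|u w]; rewrite /mutate_quiver.
  by case: ifP => _; [exact: h0 | exact: subnn].
rewrite orbC; case: ifP => _; first by case: (h2 u w); [right | left].
by case/orP: (leq_total (compose_arrows z q u w) (compose_arrows z q w u));
  rewrite -subn_eq0 => /eqP; [left | right].
Qed.

Record seed := Seed { seed_quiver : arrows; seed_var : V -> F }.

Definition mutate_var (z : V) (s : seed) : V -> F :=
  fun v =>
    if v == z then
      (\prod_(y : V) seed_var s y ^+ seed_quiver s y z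
         + \prod_(y : V) seed_var s y ^+ seed_quiver s z y) / seed_var s z
    else seed_var s v.

Definition mutate (z : V) (s : seed) : seed :=
  Seed (mutate_quiver z (seed_quiver s)) (mutate_var z s).

(* Mutation at all the vertices satisfying P, in the order of [enum P].  It is
   used below for sets of pairwise non-adjacent vertices, whose mutations
   commute. *)
Definition mutate_all (P : pred V) (s : seed) : seed :=
  foldl (fun s' z => mutate z s') s (enum P).

End Seeds.

(* Bipartite multigraphs: [part v = false] means that v lies in the part of
   index 0, and [mult u w] is the number of edges between u and w. *)
Record bigraph := Bigraph {
  vertex :> finType;
  part : vertex -> bool;
  mult : vertex -> vertex -> nat;
  mult_sym : forall u w, mult u w = mult w u;
  mult_part : forall u w, part u = part w -> mult u w = 0%N }.

Section BoxProduct.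
Variables Q Q' : bigraph.

Definition box_vertex : finType := (Q * Q')%type.

Definition box_edges (u w : box_vertex) : nat :=
  ((u.1 == w.1) * mult u.2 w.2 + (u.2 == w.2) * mult u.1 w.1)%N.

(* (i, j) stands for the block Q_i x Q'_j. *)
Definition next_block (b : bool * bool) : bool * bool :=
  match b with
  | (false, false) => (true, false)
  | (true, false) => (true, true)
  | (true, true) => (false, true)
  | (false, true) => (false, false)
  end.

Definition block (v : box_vertex) : bool * bool := (part v.1, part v.2).

Definition box_product : arrows box_vertex :=
  fun u w => if block w == next_block (block u) then box_edges u w else 0%N.

Lemma box_is_quiver : is_quiver box_product.
Proof.
rewrite /box_product; split=> [u|u w].
  by case: (block u) => [[] []].
case: eqP => [->|_]; last by left.
by case: (block u) => [[] []]; right.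
Qed.

Definition black : pred box_vertex := fun v => part v.1 == part v.2.
Definition white : pred box_vertex := fun v => ~~ black v.

End BoxProduct.

(* The path A_m and the cycle A_(2n-1)^(1).  For n = 1 the two summands of
   [cycle_mult] coincide and give the double edge.  Both are bipartitioned by
   parity.  The opposite bipartition of the path gives an isomorphic quiver
   with the same black vertices: rotate the cycle by one step. *)
Definition path_mult (m : nat) (i j : 'I_m) : nat :=
  ((i.+1 == j :> nat) + (j.+1 == i :> nat))%N.

Lemma path_mult_sym m (i j : 'I_m) : path_mult i j = path_mult j i.
Proof. exact: addnC. Qed.

Lemma path_mult_part m (i j : 'I_m) : odd i = odd j -> path_mult i j = 0%N.
Proof. by rewrite /path_mult => h; case: eqP => // e; [|case: eqP => // e']; lia. Qed.

Definition path_graph (m : nat) : bigraph :=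
  Bigraph (part := fun i : 'I_m => odd i)
    (@path_mult_sym m) (@path_mult_part m).

Definition cycle_mult (n : nat) (i j : 'I_(2 * n)) : nat :=
  ((i.+1 %% (2 * n) == j :> nat) + (j.+1 %% (2 * n) == i :> nat))%N.

Lemma cycle_mult_sym n (i j : 'I_(2 * n)) : cycle_mult i j = cycle_mult j i.
Proof. exact: addnC. Qed.

Lemma cycle_mult_part n (i j : 'I_(2 * n)) :
  odd i = odd j -> cycle_mult i j = 0%N.
Proof.
have odd_succ (k : nat) : odd (k.+1 %% (2 * n))%N = ~~ odd k.
  have := congr1 odd (divn_eq k.+1 (2 * n)).
  by rewrite oddD !oddM /= andbF.
rewrite /cycle_mult => h.
have neq (k l : 'I_(2 * n)) : odd k = odd l ->
    ((k.+1 %% (2 * n))%N == l :> nat) = false.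
  move=> e; apply/eqP => /(congr1 odd).
  by rewrite odd_succ e; case: (odd l).
by rewrite !neq.
Qed.

Definition cycle_graph (n : nat) : bigraph :=
  Bigraph (part := fun i : 'I_(2 * n) => odd i)
    (@cycle_mult_sym n) (@cycle_mult_part n).

(* The field C(x_v : v in V), where C = R[i]; the indeterminate x_v is the
   one of index [enum_rank v]. *)
Definition ratfield (R : realType) (V : finType) : fieldType :=
  {fraction {mpoly R[i][#|V|]}}.

Definition ratconst (R : realType) (V : finType) (c : R[i]) : ratfield R V :=
  tofrac (c%:MP_[#|V|]).

Definition ratvar (R : realType) (V : finType) (v : V) : ratfield R V :=
  tofrac ('X_(enum_rank v) : {mpoly R[i][#|V|]}).

Record automorphism (F : fieldType) := Automorphism {
  aut :> {rmorphism F -> F};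
  aut_inv : F -> F;
  autK : cancel aut aut_inv;
  aut_invK : cancel aut_inv aut }.

Definition autz (F : fieldType) (mu : automorphism F) (k : int) (x : F) : F :=
  match k with
  | Posz j => iter j mu x
  | Negz j => iter j.+1 (aut_inv mu) x
  end.

Section BipartiteMutation.
Variables (R : realType) (Q Q' : bigraph).
Local Notation V := (box_vertex Q Q').

Definition initial_seed : seed V (ratfield R V) :=
  Seed (@box_product Q Q') (@ratvar R V).

Definition mutated_seed : seed V (ratfield R V) :=
  mutate_all (@white Q Q') (mutate_all (@black Q Q') initial_seed).

(* These two conditions determine mu, since the constants and the x_v
   generate the field. *)
Definition is_bipartite_mutation (mu : automorphism (ratfield R V)) : Prop :=
  (forall c : R[i], mu (ratconst V c) = ratconst V c) /\
  (forall v : V, mu (ratvar R v) = seed_var mutated_seed v).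

End BipartiteMutation.

Definition linearizable_of_order (F : fieldType) (r : nat) (a : int -> F) :
    Prop :=
  exists c : 'I_r -> F,
    forall k : int, a k = \sum_(i < r) c i * a (k - i.+1%:Z).

Definition linearizable (F : fieldType) (a : int -> F) : Prop :=
  exists r : nat, linearizable_of_order r a.

Definition linearizable_at (F : fieldType) (mu : automorphism F) (x : F) :
    Prop :=
  linearizable (fun k : int => autz mu k x).

(* Main.v *)
From HB Require Import structures.
Require Import Defs.
From mathcomp Require Import all_boot all_order all_algebra.
From mathcomp Require Import reals.
From mathcomp Require Import fraction generic_quotient complex mpoly perm zify ring.

Set Implicit Arguments.
Unset Strict Implicit.
Unset Printing Implicit Defensive.

Import GRing.Theory.
Local Open Scope ring_scope.

(* In light-cone coordinates the variables form rows E_1, .., E_m, with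
   E_0 = E_(m+1) = 1, satisfying the octahedron recurrence
     E_s(a,b) E_s(a+1,b+1)
       = E_s(a+1,b) E_s(a,b+1) + E_(s+1)(a,b) E_(s-1)(a+1,b+1),
   which is Dodgson condensation: E_s(a,b) is the s x s minor of the array
   w = E_1 with corner (a,b).  So the solid (m+1)-minors of w are 1 and the
   (m+2)-minors vanish, hence w(a,b) = u_a v_b with u_a and v_b in F^(m+1).
   The cycle of length 2n makes w invariant under (a,b) -> (a+n,b-n), and this
   gives one matrix N with u_(a+n) = u_a N and v_(b+n) = N v_b.  As mu shifts
   (a,b) by (1,1), the orbit of a variable is a polynomial in sequences that
   satisfy linear recurrences with constant coefficients.

   The automorphism exists because mu = s_black s_white, where s_P exchanges the
   variables in P and fixes the others; both are involutions. *)

(** * Minors and Dodgson condensation *)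

Section Minors.
Variable F : fieldType.
Implicit Types f : nat -> nat -> F.

Definition minor s f : F := \det (\matrix_(i < s, j < s) f i j).

Lemma eq_minor s f g :
  (forall i j, (i < s)%N -> (j < s)%N -> f i j = g i j) -> minor s f = minor s g.
Proof. by move=> e; congr (\det _); apply/matrixP=> i j; rewrite !mxE e. Qed.

Lemma minor0 f : minor 0 f = 1.
Proof. exact: det_mx00. Qed.

Lemma minor1 f : minor 1 f = f 0%N 0%N.
Proof. by rewrite /minor det_mx11 mxE. Qed.

(** Block elimination: the left factor is unitriangular, so beside [A] only its Schur complement
    contributes. *)
Lemma det_schur s t (A : 'M[F]_s) (B : 'M_(s, t)) (C : 'M_(t, s)) (D : 'M_t) :
  A \in unitmx ->
  \det (block_mx A B C D) = \det A * \det (D - C *m invmx A *m B).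
Proof.
move=> uA.
have -> : block_mx A B C D =
    block_mx 1%:M 0 (C *m invmx A) 1%:M *m block_mx A B 0 (D - C *m invmx A *m B).
  by rewrite mulmx_block !mul1mx !mul0mx !addr0 mulmxKV // addrC subrK.
by rewrite det_mulmx det_lblock det_ublock !det1 !mul1r.
Qed.

Definition border_row s f p : 'rV[F]_s := \row_j f p j.
Definition border_col s f q : 'cV[F]_s := \col_i f i q.

Definition schur_entry s f p q : F :=
  f p q - (border_row s f p *m invmx (\matrix_(i < s, j < s) f i j)
             *m border_col s f q) 0 0.

Definition bordered s f p q : F :=
  minor s.+1 (fun i j => f (if i == s then p else i) (if j == s then q else j)).

Lemma borderedE s f p q : minor s f != 0 ->
  bordered s f p q = minor s f * schur_entry s f p q.
Proof.
move=> nz; rewrite /bordered -addn1 /minor.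
have -> : \matrix_(i < s + 1, j < s + 1)
     f (if i == s :> nat then p else i) (if j == s :> nat then q else j)
  = block_mx (\matrix_(i < s, j < s) f i j) (border_col s f q)
      (border_row s f p) (f p q)%:M.
  apply/matrixP => i j; rewrite !mxE.
  case: splitP => i' /= ->; rewrite mxE; case: splitP => j' /= ->; rewrite !mxE.
  - by rewrite !ltn_eqF.
  - by rewrite ltn_eqF // (ord1 j') addn0 eqxx.
  - by rewrite (ltn_eqF (ltn_ord j')) (ord1 i') addn0 eqxx.
  by rewrite (ord1 j') (ord1 i') addn0 eqxx.
rewrite det_schur ?unitmxE ?unitfE //; congr (_ * _).
by rewrite det_mx11 /schur_entry mxE [X in X + _]mxE [X in _ + X]mxE.
Qed.

(** Sylvester's identity for two borders: both sides are the square of [minor s f] times the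
    determinant of the 2 x 2 Schur complement. *)
Lemma sylvester2 s f : minor s f != 0 ->
  minor s.+2 f * minor s f =
    bordered s f s s * bordered s f s.+1 s.+1 - bordered s f s s.+1 * bordered s f s.+1 s.
Proof.
move=> nz; rewrite !borderedE //.
have -> : minor s.+2 f = minor s f *
   (schur_entry s f s s * schur_entry s f s.+1 s.+1
    - schur_entry s f s s.+1 * schur_entry s f s.+1 s); last by ring.
rewrite -[in LHS]addn2 /minor.
have -> : \matrix_(i < s + 2, j < s + 2) f i j
  = block_mx (\matrix_(i < s, j < s) f i j) (\matrix_(i, j) f i (s + j)%N)
      (\matrix_(i, j) f (s + i)%N j) (\matrix_(i, j) f (s + i)%N (s + j)%N).
  apply/matrixP => i j; rewrite !mxE.
  by case: splitP => i' /= ->; rewrite mxE; case: splitP => j' /= ->; rewrite !mxE.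
rewrite det_schur ?unitmxE ?unitfE //; congr (_ * _).
set D := _ - _.
have DE i j : D i j = schur_entry s f (s + i) (s + j).
  rewrite !mxE /schur_entry; congr (_ - _); rewrite mxE.
  apply: eq_bigr => k _; rewrite !mxE; congr (_ * _).
  by apply: eq_bigr => l _; rewrite !mxE.
move: D DE => D DE.
rewrite (expand_det_row _ 0) !big_ord_recl big_ord0 /cofactor !det_mx11 !mxE !DE /=.
by rewrite /bump /= ?addn0 ?addn1 expr1; ring.
Qed.

(* Moves the index 0 to the position s, so that the interior of a window
   becomes its leading block. *)
Definition cyc s i : nat := if (i < s)%N then i.+1 else if i == s then 0%N else i.

Lemma cyc_perm s t : (s < t)%N ->
  exists p : {perm 'I_t}, forall i : 'I_t, p i = cyc s i :> nat.
Proof.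
move=> st.
have lt (i : 'I_t) : (cyc s i < t)%N.
  rewrite /cyc; case: (ltnP i s) => [h|_]; first exact: leq_ltn_trans h st.
  by case: ifP => // _; exact: leq_ltn_trans st.
have inj : injective (fun i => Ordinal (lt i)).
  move=> i j [] e; apply: val_inj => /=; move: e; rewrite /cyc.
  by do 2 (case: ltnP => ?); do ?(case: (@eqP nat) => ?); lia.
by exists (perm inj) => i; rewrite permE.
Qed.

(** The sign is chosen before [f], so the same sign serves rows and, by transposition, columns; it
    disappears when both are cycled. *)
Lemma minor_cyc_row s t : (s < t)%N -> exists b : bool, forall f,
  minor t (fun i j => f (cyc s i) j) = (-1) ^+ b * minor t f.
Proof.
move=> /cyc_perm[p pE]; exists (odd_perm p) => f.
rewrite /minor -det_perm -det_mulmx -row_permE; congr (\det _).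
by apply/matrixP => i j; rewrite !mxE pE.
Qed.

Lemma minor_tr t f : minor t (fun i j => f j i) = minor t f.
Proof.
by rewrite /minor -[in RHS]det_tr; congr (\det _); apply/matrixP=> i j; rewrite !mxE.
Qed.

(** Sylvester's identity for the array reindexed by [cyc s]: the interior becomes the leading block,
    bordered by the outer indices 0 and s+1. *)
Lemma dodgson s f : minor s (fun i j => f i.+1 j.+1) != 0 ->
  minor s.+2 f * minor s (fun i j => f i.+1 j.+1) =
  minor s.+1 f * minor s.+1 (fun i j => f i.+1 j.+1)
  - minor s.+1 (fun i j => f i.+1 j) * minor s.+1 (fun i j => f i j.+1).
Proof.
move=> nz; pose g i j := f (cyc s i) (cyc s j).
have gE : minor s g = minor s (fun i j => f i.+1 j.+1).
  by apply: eq_minor => i j si sj; rewrite /g /cyc si sj.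
have := @sylvester2 s g; rewrite gE => /(_ nz).
have [b bE] := minor_cyc_row (ltnSn s).
have [b2 b2E] := minor_cyc_row (leqnSn s.+1).
have bEc h : minor s.+1 (fun i j => h i (cyc s j)) = (-1) ^+ b * minor s.+1 h.
  by rewrite -minor_tr (bE (fun i j => h j i)) minor_tr.
have b2Ec h : minor s.+2 (fun i j => h i (cyc s j)) = (-1) ^+ b2 * minor s.+2 h.
  by rewrite -minor_tr (b2E (fun i j => h j i)) minor_tr.
have sq (c : bool) : (-1) ^+ c * (-1) ^+ c = 1 :> F.
  by rewrite -exprMn mulrNN mulr1 expr1n.
have cycL i : (i < s)%N -> cyc s i = i.+1 by rewrite /cyc => ->.
have -> : minor s.+2 g = minor s.+2 f.
  by rewrite /g (b2E (fun i j => f i (cyc s j))) b2Ec mulrA sq mul1r.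
have -> : bordered s g s s = minor s.+1 f.
  rewrite /bordered -[RHS]mul1r -(sq b) -mulrA -bEc -(bE (fun i j => f i (cyc s j))).
  by apply: eq_minor => i j _ _; rewrite /g; do 2 (case: eqP => [->|_]).
have cS i : (i < s.+1)%N -> cyc s (if i == s then s.+1 else i) = i.+1.
  rewrite ltnS leq_eqVlt => /predU1P[->|h]; last by rewrite ltn_eqF // cycL.
  by rewrite eqxx /cyc ltnNge leqnSn /= eqn_leq ltnn.
have cE i : cyc s (if i == s then s else i) = cyc s i by case: eqP => [->|].
have -> : bordered s g s.+1 s.+1 = minor s.+1 (fun i j => f i.+1 j.+1).
  by apply: eq_minor => i j hi hj; rewrite /g !cS.
(* Each mixed minor has only its rows or only its columns cycled and keeps a sign; the two signs are
   equal and their product is 1. *)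
have -> : bordered s g s s.+1 = (-1) ^+ b * minor s.+1 (fun i j => f i j.+1).
  rewrite -(bE (fun i j => f i j.+1)).
  by apply: eq_minor => i j hi hj; rewrite /g cE cS.
have -> : bordered s g s.+1 s = (-1) ^+ b * minor s.+1 (fun i j => f i.+1 j).
  rewrite -bEc.
  by apply: eq_minor => i j hi hj; rewrite /g cE cS.
by move=> ->; rewrite mulrACA sq mul1r; congr (_ - _); rewrite mulrC.
Qed.
End Minors.

(** * Arrays of finite rank and C-finite sequences *)

Lemma int_shift_ind (P : int -> Prop) :
  P 0 -> (forall k, P k <-> P (k + 1)) -> forall k, P k.
Proof.
move=> P0 PS; elim/int_ind => [//|k|k] IH.
  have -> : k.+1%:Z = k%:Z + 1 by lia.
  by case: (PS k%:Z) => h _; exact: h.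
have [_ h] := PS (- k.+1%:Z); apply: h.
by have -> : - k.+1%:Z + 1 = - k%:Z by lia.
Qed.

(** * Factorisation of an array whose (r+1)-minors vanish *)

Section Rank.
Variables (F : fieldType) (w : int -> int -> F) (r : nat).

Definition window (a b : int) : 'M[F]_r := \matrix_(i, j) w (a + i%:Z) (b + j%:Z).

Definition wminor s (a b : int) : F :=
  minor s (fun i j => w (a + i%:Z) (b + j%:Z)).

Lemma det_window a b : \det (window a b) = wminor r a b.
Proof. by []. Qed.

Lemma wminor_dodgson s a b : wminor s (a + 1) (b + 1) != 0 ->
  wminor s.+2 a b * wminor s (a + 1) (b + 1) =
  wminor s.+1 a b * wminor s.+1 (a + 1) (b + 1)
  - wminor s.+1 (a + 1) b * wminor s.+1 a (b + 1).
Proof.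
have e (a' : int) (i : nat) : a' + 1 + i%:Z = a' + i.+1%:Z by lia.
have e11 t : wminor t (a + 1) (b + 1) = minor t (fun i j => w (a + i.+1%:Z) (b + j.+1%:Z)).
  by apply: eq_minor => i j _ _; rewrite !e.
have e10 t : wminor t (a + 1) b = minor t (fun i j => w (a + i.+1%:Z) (b + j%:Z)).
  by apply: eq_minor => i j _ _; rewrite !e.
have e01 t : wminor t a (b + 1) = minor t (fun i j => w (a + i%:Z) (b + j.+1%:Z)).
  by apply: eq_minor => i j _ _; rewrite !e.
rewrite !e11 !e10 !e01; exact: (@dodgson _ s (fun i j => w (a + i%:Z) (b + j%:Z))).
Qed.

(** The coefficients are the last row times the inverse of the leading block. They fit the first r
    columns by construction, and column r because the Schur complement entry is 0. *)
Lemma last_row_combination (f : nat -> nat -> F) : minor r f != 0 -> minor r.+1 f = 0 ->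
  exists c : 'I_r -> F, forall j, (j <= r)%N -> f r j = \sum_i c i * f i j.
Proof.
move=> nz z; set A := \matrix_(i < r, j < r) f i j.
have uA : A \in unitmx by rewrite unitmxE unitfE.
exists (fun i => (border_row r f r *m invmx A) 0 i) => j.
rewrite leq_eqVlt => /predU1P[->|jr]; last first.
  have := congr1 (fun M : 'rV_r => M 0 (Ordinal jr)) (mulmxKV uA (border_row r f r)).
  by rewrite /border_row !mxE /= => <-; apply: eq_bigr => i _; rewrite [A _ _]mxE.
have : bordered r f r r = 0.
  rewrite -z; apply: eq_minor => i k _ _.
  by do 2 (case: eqP => [->|_]).
rewrite borderedE // => /eqP; rewrite mulf_eq0 (negPf nz) subr_eq0 => /eqP ->.
by rewrite mxE; apply: eq_bigr => i _; rewrite [border_col _ _ _ _ _]mxE.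
Qed.

Hypothesis wr_neq0 : forall a b, wminor r a b != 0.
Hypothesis wr1_eq0 : forall a b, wminor r.+1 a b = 0.

Lemma window_unit a b : window a b \in unitmx.
Proof. by rewrite unitmxE unitfE det_window. Qed.

(** The relation among r+1 rows holds on r+1 consecutive columns, which cover two adjacent windows;
    hence one [C] for both. *)
Lemma window_transfer a b : exists C : 'M_r,
  C *m window a b = window (a + 1) b /\ C *m window a (b + 1) = window (a + 1) (b + 1).
Proof.
have [c cE] := last_row_combination (wr_neq0 a b) (wr1_eq0 a b).
(* Companion form: the upper rows shift the window, the last one applies the relation. *)
pose C := \matrix_(i < r, j < r) if (i.+1 < r)%N then (i.+1 == j :> nat)%:R else c j.
have CE b' : (forall j : 'I_r, exists2 j' : nat, (j' <= r)%N & b' + j%:Z = b + j'%:Z) ->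
    C *m window a b' = window (a + 1) b'.
  move=> h; apply/matrixP => i j; rewrite !mxE; have [j' j'r ej] := h j.
  case: (ltnP i.+1 r) => ir.
    rewrite (bigD1 (Ordinal ir)) //= big1 => [|k]; last first.
      by rewrite !mxE ir eq_sym -(inj_eq val_inj) /= => /negPf ->; rewrite mul0r.
    rewrite addr0 !mxE ir eqxx mul1r /=; congr w; lia.
  have -> : a + 1 + i%:Z = a + r%:Z by have := ltn_ord i; lia.
  by rewrite ej cE //; apply: eq_bigr => k _; rewrite !mxE ltnNge ir /= ej.
exists C; split; apply: CE => j; first by exists j => //; exact: ltnW.
by exists j.+1 => //; lia.
Qed.

Definition transfer a b := window (a + 1) b *m invmx (window a b).

Lemma transfer_const a b : transfer a b = transfer a 0.
Proof.
have step b' : transfer a (b' + 1) = transfer a b'.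
  have [C [C0 C1]] := window_transfer a b'.
  by rewrite /transfer -C0 -C1 !mulmxK ?window_unit.
move: b; apply: int_shift_ind => // k; split=> [<-|<-]; first exact: step.
by rewrite step.
Qed.

Definition basis_change a b := window a b *m invmx (window 0 b).

(** [basis_change a b] is a product of transfer matrices or their inverses, and these do not depend
    on [b]. *)
Lemma basis_change_const a b : basis_change a b = basis_change a 0.
Proof.
have step a' b' : basis_change (a' + 1) b' = transfer a' 0 *m basis_change a' b'.
  rewrite -(transfer_const _ b') /transfer /basis_change mulmxA mulmxKV //.
  exact: window_unit.
have uT a' : transfer a' 0 \in unitmx.
  by rewrite unitmx_mul unitmx_inv !window_unit.
move: a; apply: int_shift_ind => [|k].
  by rewrite /basis_change !mulmxV ?window_unit.
rewrite !step; split=> [->//|e].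
by rewrite -[LHS](mulKmx (uT k)) e mulKmx.
Qed.

(** The top left entry reads w(a,b) = u_a v_b, with u_a row 0 of [basis_change a 0] and v_b column 0
    of [window 0 b]. *)
Lemma window_factor a b : window a b = basis_change a 0 *m window 0 b.
Proof. by rewrite -(basis_change_const a b) mulmxKV // window_unit. Qed.

Variable p : int.
Hypothesis w_per : forall a b, w (a + p) (b - p) = w a b.

(** The matrix N by which a shift by the period acts: on the right of the u_a, on the left of the
    v_b. *)
Definition monodromy := window 0 p *m invmx (window 0 0).

Lemma window_per a b : window (a + p) b = window a (b + p).
Proof.
apply/matrixP => i j; rewrite !mxE -(w_per (a + i%:Z)); congr w; ring.
Qed.

Lemma basis_change_shift a : basis_change (a + p) 0 = basis_change a 0 *m monodromy.
Proof.
by rewrite {1}/basis_change window_per add0r window_factor -!mulmxA.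
Qed.

Lemma window_shift b : window 0 (b + p) = monodromy *m window 0 b.
Proof.
rewrite -window_per add0r window_factor; congr (_ *m _).
by rewrite /basis_change /monodromy -[in LHS](add0r p) window_per add0r.
Qed.
End Rank.

(** * Sequences governed by first-order linear systems *)

Section CFinite.
Variable F : fieldType.
Implicit Types a : int -> F.

(** A form suited to closure properties: sums come from the direct sum of two systems, products from
    their tensor product. *)
Definition cfinite a : Prop :=
  exists (I : finType) (g : I -> int -> F) (B : I -> I -> F) (c : I -> F),
    (forall i k, g i (k + 1) = \sum_j B i j * g j k) /\
    (forall k, a k = \sum_i c i * g i k).

Lemma eq_cfinite a b : a =1 b -> cfinite a -> cfinite b.
Proof.
by move=> e [I [g [B [c [h1 h2]]]]]; exists I, g, B, c; split=> // k; rewrite -e.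
Qed.

Lemma cfinite_const x : cfinite (fun _ => x).
Proof.
exists unit, (fun _ _ => 1), (fun _ _ => 1), (fun _ => x).
by split=> *; rewrite (bigD1 tt) //= big1 => [|[]//]; rewrite mulr1 addr0.
Qed.

Lemma cfiniteD a b : cfinite a -> cfinite b -> cfinite (fun k => a k + b k).
Proof.
move=> [I [g [B [c [h1 h2]]]]] [I' [g' [B' [c' [h1' h2']]]]].
exists (I + I')%type, (fun i => match i with inl i => g i | inr i => g' i end).
exists (fun i j => match i, j with inl i, inl j => B i j | inr i, inr j => B' i j
                   | _, _ => 0 end).
exists (fun i => match i with inl i => c i | inr i => c' i end).
split=> [[i|i] k|k]; rewrite big_sumType /= ?h2 ?h2' //.
  by rewrite h1 [X in _ = _ + X]big1 ?addr0 // => j _; rewrite mul0r.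
by rewrite h1' [X in _ = X + _]big1 ?add0r // => j _; rewrite mul0r.
Qed.

Lemma cfiniteM a b : cfinite a -> cfinite b -> cfinite (fun k => a k * b k).
Proof.
move=> [I [g [B [c [h1 h2]]]]] [I' [g' [B' [c' [h1' h2']]]]].
exists (I * I')%type, (fun i k => g i.1 k * g' i.2 k).
exists (fun i j => B i.1 j.1 * B' i.2 j.2), (fun i => c i.1 * c' i.2).
split=> [i k|k]; rewrite ?h1 ?h1' ?h2 ?h2' big_distrlr pair_bigA /=.
  by apply: eq_bigr => j _; rewrite mulrACA.
by apply: eq_bigr => j _; rewrite mulrACA.
Qed.

Lemma cfinite_sum (I : Type) (s : seq I) (P : pred I) (f : I -> int -> F) :
  (forall i, P i -> cfinite (f i)) -> cfinite (fun k => \sum_(i <- s | P i) f i k).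
Proof.
move=> h; elim: s => [|i s IH].
  by apply: eq_cfinite (cfinite_const 0) => k; rewrite big_nil.
apply: (@eq_cfinite (fun k => (if P i then f i k else 0) + \sum_(i <- s | P i) f i k)).
  by move=> k; rewrite big_cons; case: (P i); rewrite ?add0r.
apply: cfiniteD IH; case: (boolP (P i)) => Pi; first exact: h.
exact: cfinite_const.
Qed.

Lemma cfinite_prod (I : Type) (s : seq I) (P : pred I) (f : I -> int -> F) :
  (forall i, P i -> cfinite (f i)) -> cfinite (fun k => \prod_(i <- s | P i) f i k).
Proof.
move=> h; elim: s => [|i s IH].
  by apply: eq_cfinite (cfinite_const 1) => k; rewrite big_nil.
apply: (@eq_cfinite (fun k => (if P i then f i k else 1) * \prod_(i <- s | P i) f i k)).
  by move=> k; rewrite big_cons; case: (P i); rewrite ?mul1r.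
apply: cfiniteM IH; case: (boolP (P i)) => Pi; first exact: h.
exact: cfinite_const.
Qed.

Lemma cfinite_minor s (f : nat -> nat -> int -> F) :
  (forall i j, cfinite (f i j)) -> cfinite (fun k => minor s (fun i j => f i j k)).
Proof.
move=> h; apply: cfinite_sum => q _; apply: cfiniteM; first exact: cfinite_const.
apply: (@eq_cfinite (fun k => \prod_(i < s) f i (q i) k)).
  by move=> k; apply: eq_bigr => i _; rewrite mxE.
exact: cfinite_prod.
Qed.

(* The shifts by 0, .., p of the family are stable under the shift by 1. *)
Lemma cfinite_step p (I : finType) (g : I -> int -> F) (B : I -> I -> F) i0 :
  (forall i k, g i (k + p.+1%:Z) = \sum_j B i j * g j k) -> cfinite (g i0).
Proof.
move=> h; exists (I * 'I_p.+1)%type, (fun (i : I * 'I_p.+1) k => g i.1 (k + i.2%:Z)).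
exists (fun i j : I * 'I_p.+1 => if (i.2 < p)%N then ((i.1 == j.1) && (i.2.+1 == j.2 :> nat))%:R
                   else B i.1 j.1 *+ (j.2 == 0 :> nat)).
exists (fun i => (i == (i0, ord0))%:R); split=> [[i e] k|k] /=; last first.
  rewrite (bigD1 (i0, ord0)) //= eqxx mul1r addr0 big1 ?addr0 // => j /negPf ->.
  by rewrite mul0r.
case: ltnP => ep.
  have ep1 : (e.+1 < p.+1)%N by [].
  rewrite (bigD1 (i, Ordinal ep1)) //= !eqxx mul1r big1 ?addr0.
    by congr g; lia.
  move=> [j e'] /negPf; rewrite /= -pair_eqE /= -(inj_eq val_inj) /=.
  by rewrite (eq_sym j) (eq_sym (e' : nat)) => ->; rewrite mul0r.
have -> : k + 1 + e%:Z = k + p.+1%:Z by have := ltn_ord e; lia.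
rewrite h -(pair_bigA _ (fun j (e' : 'I_p.+1) => B i j *+ (e' == 0 :> nat) * g j (k + e'%:Z))) /=.
apply: eq_bigr => j _; rewrite big_ord_recl /= addr0 big1 ?addr0 // => l _.
by rewrite mul0r.
Qed.

(** By Cayley-Hamilton the characteristic polynomial of the system annihilates the sequence; being
    monic, it can be solved for the leading term. *)
Lemma cfinite_linearizable a : cfinite a -> linearizable a.
Proof.
move=> [I [g [B [c [gB ac]]]]].
(* The extra coordinate is identically 0; it makes the matrix size N+1 positive even when [I] is
   empty. *)
pose J : finType := (unit + I)%type; pose N := #|I|.
have NE : #|J| = N.+1 by rewrite card_sum card_unit.
pose ev (i : 'I_N.+1) : J := enum_val (cast_ord (esym NE) i).
pose ge (o : J) k := if o is inr i then g i k else 0.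
pose Be (o o' : J) := if (o, o') is (inr i, inr j) then B i j else 0.
pose ce (o : J) := if o is inr i then c i else 0.
have inrE (f : J -> F) : f (inl tt) = 0 -> \sum_o f o = \sum_i f (inr i).
  by move=> f0; rewrite big_sumType /= big1 ?add0r // => -[].
have gBe o k : ge o (k + 1) = \sum_o' Be o o' * ge o' k.
  rewrite inrE /= ?mulr0 //; case: o => [[]|i] /=; last exact: gB.
  by rewrite big1 // => j _; rewrite mul0r.
have ace k : a k = \sum_o ce o * ge o k by rewrite inrE /= ?mul0r.
have re (f : J -> F) : \sum_o f o = \sum_i f (ev i).
  rewrite (reindex ev) //; exists (fun o => cast_ord NE (enum_rank o)) => o _.
    by rewrite /ev enum_valK cast_ordKV.
  by rewrite /ev cast_ordK enum_rankK.
pose M : 'M[F]_N.+1 := \matrix_(i, j) Be (ev i) (ev j).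
pose y k : 'cV[F]_N.+1 := \col_i ge (ev i) k.
pose rho : 'rV[F]_N.+1 := \row_i ce (ev i).
have yM k (i : nat) : y (k + i%:Z) = M ^+ i *m y k.
  elim: i => [|i IH]; first by rewrite addr0 expr0 mul1mx.
  have -> : k + i.+1%:Z = k + i%:Z + 1 by lia.
  rewrite exprS -mulmxA -IH; apply/colP => l; rewrite !mxE gBe re.
  by apply: eq_bigr => j _; rewrite !mxE.
have ay k : a k = (rho *m y k) 0 0.
  by rewrite ace re mxE; apply: eq_bigr => j _; rewrite !mxE.
pose chi := char_poly M.
have key k : \sum_(i < N.+2) chi`_i * a (k + i%:Z) = 0.
  transitivity ((rho *m horner_mx M chi *m y k) 0 0); last first.
    by rewrite Cayley_Hamilton mulmx0 mul0mx mxE.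
  rewrite /horner_mx /horner_morph horner_coef.
  rewrite size_map_poly size_char_poly mulmx_sumr mulmx_suml summxE.
  apply: eq_bigr => i _; rewrite ay yM coef_map /=.
  have -> : (chi`_i)%:M * M ^+ i = chi`_i *: M ^+ i by exact: mul_scalar_mx.
  by rewrite -scalemxAr -scalemxAl mulmxA [RHS]mxE.
(* The lag i+1 below the top degree N+1 is the degree N-i, that is [rev_ord i]. *)
exists N.+1, (fun i => - chi`_(rev_ord i)) => k.
have := key (k - N.+1%:Z); rewrite big_ord_recr /=.
have /monicP := char_poly_monic M; rewrite /lead_coef size_char_poly /= -/chi => ->.
rewrite mul1r subrK addrC => /eqP; rewrite addr_eq0 => /eqP ->.
rewrite -sumrN (reindex_inj rev_ord_inj) /=; apply: eq_bigr => i _.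
by rewrite mulNr; congr (- (_ * a _)); have := ltn_ord i; lia.
Qed.
End CFinite.

Section RankLinearizable.
Variables (F : fieldType) (w : int -> int -> F) (r p : nat).
Hypothesis wr_neq0 : forall a b, wminor w r.+1 a b != 0.
Hypothesis wr1_eq0 : forall a b, wminor w r.+2 a b = 0.
Hypothesis w_per : forall a b, w (a + p.+1%:Z) (b - p.+1%:Z) = w a b.

(** Both factors satisfy a system under the shift by p+1, with the monodromy as matrix; it is
    transposed for [u], where it acts from the right. *)
Lemma cfinite_diagonal a b : cfinite (fun k => w (a + k) (b + k)).
Proof.
pose u i k := basis_change w r.+1 (a + k) 0 ord0 i.
pose v i k := window w r.+1 0 (b + k) i ord0.
apply: (@eq_cfinite _ (fun k => \sum_i u i k * v i k)).
  move=> k; have /matrixP/(_ ord0 ord0) := window_factor wr_neq0 wr1_eq0 (a + k) (b + k).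
  by rewrite mxE !addr0 mxE.
apply: cfinite_sum => i _; apply: cfiniteM.
  apply: (cfinite_step (p := p) (B := fun i j => monodromy w r.+1 p.+1 j i)) => {}i k.
  rewrite /u addrA (basis_change_shift wr_neq0 wr1_eq0 w_per) mxE.
  by apply: eq_bigr => j _; rewrite mulrC.
apply: (cfinite_step (p := p) (B := fun i j => monodromy w r.+1 p.+1 i j)) => {}i k.
by rewrite /v addrA (window_shift wr_neq0 wr1_eq0 w_per) mxE.
Qed.

Lemma linearizable_wminor s a b : linearizable (fun k => wminor w s (a + k) (b + k)).
Proof.
apply: cfinite_linearizable; apply: cfinite_minor => i j.
apply: eq_cfinite (cfinite_diagonal (a + i%:Z) (b + j%:Z)) => k.
by congr w; ring.
Qed.
End RankLinearizable.

(** * Bipartite mutation of a box product *)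

Section MutationOfIndependentSets.
Variables (V : finType) (F : fieldType).
Implicit Types (q : arrows V) (x : V -> F) (s : seq V) (S : seed V F).

Definition exchange x q v : F :=
  \prod_y x y ^+ q y v + \prod_y x y ^+ q v y.

(** The skew-symmetric exchange matrix, in which the removal of 2-cycles is an ordinary
    subtraction. *)
Definition signed q u w : int := (q u w)%:Z - (q w u)%:Z.

Lemma signed_inj q q' : is_quiver q -> is_quiver q' ->
  (forall u w, signed q u w = signed q' u w) -> forall u w, q u w = q' u w.
Proof.
move=> [_ q2] [_ q2'] e u w; have := e u w; rewrite /signed.
by case: (q2 u w) => ->; case: (q2' u w) => ->; lia.
Qed.

Lemma mutate_signed z q u w : signed (mutate_quiver z q) u w =
  if (u == z) || (w == z) then - signed q u w
  else signed q u w + ((q u z * q z w)%:Z - (q w z * q z u)%:Z).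
Proof.
rewrite /signed /mutate_quiver [(w == z) || _]orbC; case: ifP => _; first lia.
by rewrite /compose_arrows; lia.
Qed.

Lemma mutate_near z q v : is_quiver q -> v != z -> q v z = 0%N -> q z v = 0%N ->
  forall y, mutate_quiver z q y v = q y v /\ mutate_quiver z q v y = q v y.
Proof.
move=> [_ q2] /negPf vz qvz qzv y; rewrite /mutate_quiver /compose_arrows qvz qzv vz.
rewrite !muln0 !mul0n !addn0 orbF.
case: (eqVneq y z) => [->|_] /=; first by rewrite qvz qzv.
by case: (q2 y v) => ->; rewrite !subn0 ?sub0n.
Qed.

(** By [mutate_near] each mutation leaves the arrows at the remaining vertices of [s] unchanged, so
    all of them act with the initial data and their effects add up. *)
Lemma mutate_independent s S : is_quiver (seed_quiver S) -> uniq s ->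
  {in s &, forall u w, seed_quiver S u w = 0%N} ->
  let q := seed_quiver S in
  let S' := foldl (fun S' z => mutate z S') S s in
  [/\ is_quiver (seed_quiver S'),
      forall u w, signed (seed_quiver S') u w =
        if (u \in s) || (w \in s) then - signed q u w
        else signed q u w
               + \sum_(z <- s) ((q u z * q z w)%:Z - (q w z * q z u)%:Z)
    & forall v, seed_var S' v =
        if v \in s then exchange (seed_var S) q v / seed_var S v else seed_var S v].
Proof.
elim: s S => [|z s IH] S qS.
  by move=> _ _; split=> // u w; rewrite /= big_nil addr0.
rewrite cons_uniq => /andP[zs us] ind /=.
have z0 v : v \in s -> seed_quiver S v z = 0%N /\ seed_quiver S z v = 0%N.
  by move=> vs; split; apply: ind; rewrite ?inE ?eqxx ?vs ?orbT.
have nz v : v \in s -> v != z by move=> vs; apply: contraNneq zs => <-.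
have near v : v \in s -> forall y,
   mutate_quiver z (seed_quiver S) y v = seed_quiver S y v /\
   mutate_quiver z (seed_quiver S) v y = seed_quiver S v y.
  by move=> vs; have [h1 h2] := z0 _ vs; apply: mutate_near => //; exact: nz.
have [] := IH (mutate z S) => //=.
- exact: mutate_is_quiver.
- by move=> u w us' ws; have [-> _] := near _ ws u; apply: ind; rewrite inE ?us' ?ws orbT.
move=> qS' sg va; split=> // [u w|v].
- rewrite sg !inE; case: (boolP (u \in s)) => us' /=.
    by rewrite orbT /signed; have [-> ->] := near _ us' w.
  case: (boolP (w \in s)) => ws /=.
    by rewrite !orbT /signed; have [-> ->] := near _ ws u.
  rewrite !orbF mutate_signed big_cons.
  case: ifP => [uwz|_]; last first.
    rewrite -addrA; congr (_ + (_ + _)); apply: eq_big_seq => t ts.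
    by have [-> ->] := near _ ts u; have [-> ->] := near _ ts w.
  (* One of u, w is z, which is adjacent to no t in [s]: the later mutations contribute nothing. *)
  rewrite big1_seq ?addr0 // => t /andP[_ ts].
  have [-> ->] := near _ ts u; have [-> ->] := near _ ts w.
  by have [t1 t2] := z0 _ ts; case/orP: uwz => /eqP ->; rewrite t1 t2 !muln0 ?mul0n subrr.
rewrite va inE /mutate_var; case: (boolP (v \in s)) => vs; last first.
  by rewrite orbF /=; case: eqP => [->|].
rewrite (negPf (nz _ vs)) orbT /=; congr (_ / _); have [v1 v2] := z0 _ vs.
(* The new value at z has exponent 0 here, since z and v are not adjacent. *)
by congr (_ + _); apply: eq_bigr => y _; have [h1 h2] := near _ vs y;
  rewrite ?h1 ?h2; case: (eqVneq y z) => // ->; rewrite ?v1 ?v2 !expr0.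
Qed.
End MutationOfIndependentSets.

(** * The two halves of the bipartite mutation of a box product *)

Section BoxMutation.
Variables (Q Q' : bigraph) (F : fieldType).
Local Notation V := (box_vertex Q Q').
Local Notation q := (@box_product Q Q').
Local Notation black := (@black Q Q').
Local Notation white := (@white Q Q').
Implicit Types (x : V -> F) (u v w y z : V).

(** In each factor either adjacency or equality is excluded; this form turns case analysis on the
    parts into rewriting rules. *)
Lemma mult_or_neq (G : bigraph) (a b : G) :
  if part a == part b then mult a b = 0%N else (a == b) = false.
Proof. by case: eqP => [/mult_part|h] //; apply: contra_notF h => /eqP ->. Qed.

Lemma box_out v y :
  q v y = (if black v then (v.2 == y.2) * mult v.1 y.1 else (v.1 == y.1) * mult v.2 y.2)%N.
Proof.
case: v y => [a j] [b l]; have := mult_or_neq a b; have := mult_or_neq j l.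
rewrite /box_product /block /box_edges /Defs.black /=.
by case: (part a); case: (part b); case: (part j); case: (part l) => /= e1 e2;
  rewrite ?e1 ?e2 ?mul0n ?muln0 ?addn0 ?add0n.
Qed.

Lemma box_in v y :
  q y v = (if black v then (v.1 == y.1) * mult v.2 y.2 else (v.2 == y.2) * mult v.1 y.1)%N.
Proof.
case: v y => [a j] [b l]; have := mult_or_neq a b; have := mult_or_neq j l.
rewrite /box_product /block /box_edges /Defs.black /=.
rewrite [b == a]eq_sym [l == j]eq_sym [mult b a]mult_sym [mult l j]mult_sym.
by case: (part a); case: (part b); case: (part j); case: (part l) => /= e1 e2;
  rewrite ?e1 ?e2 ?mul0n ?muln0 ?addn0 ?add0n.
Qed.

Lemma box_same_colour u w : black u = black w -> q u w = 0%N.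
Proof.
rewrite /box_product /block /Defs.black; case: u w => [a j] [b l] /=.
by case: (part a); case: (part j); case: (part b); case: (part l).
Qed.

Definition neighbours x v : F :=
  \prod_a x (a, v.2) ^+ mult v.1 a + \prod_j x (v.1, j) ^+ mult v.2 j.

Lemma eq_neighbours x x' v : (forall y, black y = ~~ black v -> x y = x' y) ->
  neighbours x v = neighbours x' v.
Proof.
move=> e; rewrite /neighbours; congr (_ + _); apply: eq_bigr => i _.
  case: (eqVneq (part v.1) (part i)) => [/mult_part ->//|h]; rewrite e //.
  by move: h; rewrite /Defs.black /=; case: (part v.1); case: (part i); case: (part v.2).
case: (eqVneq (part v.2) (part i)) => [/mult_part ->//|h]; rewrite e //.
by move: h; rewrite /Defs.black /=; case: (part v.1); case: (part i); case: (part v.2).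
Qed.

(** Incoming and outgoing arrows run along different factors. The colour decides which is which, but
    the sum is symmetric. *)
Lemma exchange_box x v : exchange x q v = neighbours x v.
Proof.
have e1 : \prod_y x y ^+ ((v.2 == y.2) * mult v.1 y.1) = \prod_a x (a, v.2) ^+ mult v.1 a.
  rewrite (eq_bigr (fun y : V => x (y.1, y.2) ^+ ((v.2 == y.2) * mult v.1 y.1))) => [|[]//].
  rewrite -(pair_bigA _ (fun a j => x (a, j) ^+ ((v.2 == j) * mult v.1 a))) /=.
  apply: eq_bigr => a _; rewrite (bigD1 v.2) //= eqxx mul1n big1 ?mulr1 // => j.
  by rewrite eq_sym => /negPf ->.
have e2 : \prod_y x y ^+ ((v.1 == y.1) * mult v.2 y.2) = \prod_j x (v.1, j) ^+ mult v.2 j.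
  rewrite (eq_bigr (fun y : V => x (y.1, y.2) ^+ ((v.1 == y.1) * mult v.2 y.2))) => [|[]//].
  rewrite -(pair_bigA _ (fun a j => x (a, j) ^+ ((v.1 == a) * mult v.2 j))) /=.
  rewrite (bigD1 v.1) //= [X in _ * X]big1 ?mulr1 => [|a].
    by apply: eq_bigr => j _; rewrite eqxx mul1n.
  by rewrite eq_sym => /negPf h; rewrite big1 // => j _; rewrite h.
rewrite /exchange /neighbours -e1 -e2.
case vb: (black v); [rewrite addrC|]; congr (_ + _); apply: eq_bigr => y _;
  by rewrite ?(box_in v y) ?(box_out v y) vb.
Qed.

(** Such a path moves first in [Q'] and then in [Q], so it passes through (u.1, w.2). The count is
    symmetric in u and w, so the arrows added by the black mutations cancel. *)
Lemma white_paths u w : white u -> white w ->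
  (\sum_z q u z * q z w = mult u.1 w.1 * mult u.2 w.2)%N.
Proof.
move=> /negPf ub /negPf wb; rewrite (bigD1 (u.1, w.2)) //= big1 => [|[b l] zn].
  by rewrite addn0 (box_out u) (box_in w) ub wb /= !eqxx !mul1n mulnC [mult w.1 _]mult_sym.
rewrite (box_out u) (box_in w) ub wb /=; move: zn; rewrite -pair_eqE /= negb_and.
by case/orP; rewrite eq_sym => /negPf ->; rewrite ?mul0n ?muln0.
Qed.

Lemma mutate_black x (S := mutate_all black (Seed q x)) :
  [/\ is_quiver (seed_quiver S),
      forall u w, seed_quiver S u w = q w u
    & forall v, seed_var S v = if black v then neighbours x v / x v else x v].
Proof.
have [|||] := @mutate_independent V F (enum black) (Seed q x).
- exact: box_is_quiver.
- exact: enum_uniq.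
- by move=> u w; rewrite !mem_enum => hu hw; apply: box_same_colour; rewrite [LHS]hu [RHS]hw.
rewrite -/(mutate_all black _) -/S => qS sg va; split=> // [|v]; last first.
  by rewrite va mem_enum exchange_box.
apply: signed_inj => // [|u w].
  by case: (box_is_quiver Q Q') => h0 h1; split=> [u|u w]; [exact: h0 | exact: h1].
rewrite sg !mem_enum -[RHS]opprB -/(signed q u w); case: ifP => // /norP[ub wb].
have -> : signed q u w = 0.
  by rewrite /signed !box_same_colour // (negPf (ub : ~~ black u)) (negPf (wb : ~~ black w)).
rewrite add0r oppr0 big_enum /= sumrB.
have pathsE u' w' : ~~ black u' -> ~~ black w' ->
    \sum_(z in black) (q u' z * q z w')%:Z = (mult u'.1 w'.1 * mult u'.2 w'.2)%:Z.
  move=> ub' wb'; rewrite -white_paths // (big_morph Posz PoszD (erefl _)) big_mkcond.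
  apply: eq_bigr => z _; case: ifPn => // zb; rewrite box_same_colour //.
  by rewrite (negPf ub') (negPf (zb : ~~ black z)).
by rewrite !pathsE // [mult w.1 _]mult_sym [mult w.2 _]mult_sym subrr.
Qed.

Variable x : V -> F.
Local Notation x' := (seed_var (mutate_all white (mutate_all black (Seed q x)))).

Lemma mutated_black v : black v -> x' v = neighbours x v / x v.
Proof.
move=> vb; have [qS qE va] := mutate_black x.
have [||_ _ ->] := @mutate_independent V F (enum white) (mutate_all black (Seed q x)) qS.
- exact: enum_uniq.
- move=> u w; rewrite !mem_enum => /negPf hu /negPf hw.
  by rewrite qE box_same_colour // hu hw.
by rewrite mem_enum /white unfold_in /= vb va vb.
Qed.

(** The neighbours of a white vertex are black and have their final values after the first half,
    whence [x'] on the right. *)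
Lemma mutated_white v : white v -> x' v = neighbours x' v / x v.
Proof.
move=> vw; have [qS qE va] := mutate_black x.
rewrite (@eq_neighbours _ (seed_var (mutate_all black (Seed q x)))); last first.
  by move=> y; rewrite (vw : ~~ black v) => yb; rewrite mutated_black // va yb.
have [||_ _ ->] := @mutate_independent V F (enum white) (mutate_all black (Seed q x)) qS.
- exact: enum_uniq.
- move=> u w; rewrite !mem_enum => /negPf hu /negPf hw.
  by rewrite qE box_same_colour // hu hw.
rewrite mem_enum (vw : v \in white) va (negPf (vw : ~~ black v)) -exchange_box; congr (_ / _).
(* The black mutations have reversed all arrows, which swaps the two products. *)
by rewrite /exchange addrC; congr (_ + _); apply: eq_bigr => y _; rewrite qE.
Qed.
End BoxMutation.

(** * Existence of the automorphism *)

Section FractionExtension.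
Variable A : idomainType.
Local Notation K := {fraction A}.
Local Notation tofrac := (@tofrac A).

Definition numer (x : K) : A := (frac (repr x)).1.
Definition denom (x : K) : A := (frac (repr x)).2.

Lemma denom_neq0 x : denom x != 0.
Proof. exact: denom_ratioP. Qed.

Lemma fracE (x : K) : x = tofrac (numer x) / tofrac (denom x).
Proof.
have dx := denom_neq0 x.
suff e : x * tofrac (denom x) = tofrac (numer x) by rewrite -e mulfK // tofrac_eq0.
rewrite /numer /denom -{1}[x]reprK; unlock FracField.tofrac.
rewrite -[LHS]FracField.pi_mul; apply/eqmodP => /=.
rewrite /FracField.equivf /FracField.mulf /= !numden_Ratio ?oner_neq0 ?mulr1 ?mul1r //.
  by rewrite mulrC.
Qed.

Variables (L : fieldType) (h : {rmorphism A -> L}).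
Hypothesis h_eq0 : forall p, h p = 0 -> p = 0.

Definition frac_ext (x : K) : L := h (numer x) / h (denom x).

(** Independence of the chosen representative, by cross-multiplication. *)
Lemma frac_extE n d : d != 0 -> frac_ext (tofrac n / tofrac d) = h n / h d.
Proof.
have nz c : c != 0 -> h c != 0 by apply: contra_neq => /h_eq0.
move=> d0; set x := _ / _; have dx := denom_neq0 x.
apply/eqP; rewrite /frac_ext eqr_div ?nz // -!rmorphM; apply/eqP; congr (h _).
have /eqP := fracE x; rewrite {1}/x eqr_div ?tofrac_eq0 // -!rmorphM tofrac_eq.
by move=> /eqP ->.
Qed.

Lemma frac_ext_tofrac p : frac_ext (tofrac p) = h p.
Proof.
by rewrite -[tofrac p]divr1 -[X in _ / X](rmorph1 tofrac) frac_extE ?oner_neq0 // rmorph1 divr1.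
Qed.

Lemma frac_ext_zmod : zmod_morphism frac_ext.
Proof.
move=> x y; have dx := denom_neq0 x; have dy := denom_neq0 y.
have nz c : c != 0 -> h c != 0 by apply: contra_neq => /h_eq0.
rewrite [in LHS](fracE x) [in LHS](fracE y) -mulNr -rmorphN addf_div ?tofrac_eq0 //.
rewrite -!rmorphM -rmorphD frac_extE ?mulf_neq0 //.
by rewrite rmorphD !rmorphM rmorphN -addf_div ?nz // mulNr.
Qed.

Lemma frac_ext_monoid : monoid_morphism frac_ext.
Proof.
split=> [|x y]; first by rewrite -(rmorph1 tofrac) frac_ext_tofrac rmorph1.
have dx := denom_neq0 x; have dy := denom_neq0 y.
rewrite [in LHS](fracE x) [in LHS](fracE y) mulf_div -!rmorphM frac_extE ?mulf_neq0 //.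
by rewrite !rmorphM -mulf_div.
Qed.

HB.instance Definition _ := GRing.isZmodMorphism.Build K L frac_ext frac_ext_zmod.
HB.instance Definition _ := GRing.isMonoidMorphism.Build K L frac_ext frac_ext_monoid.

Lemma rmorphism_extends : exists H : {rmorphism K -> L}, forall p, H (tofrac p) = h p.
Proof. by exists frac_ext; exact: frac_ext_tofrac. Qed.
End FractionExtension.

(** * Extending a substitution that is its own inverse *)

Section InvolutionExtension.
Variables (A : idomainType) (h : {rmorphism A -> {fraction A}}).
Local Notation tofrac := (@tofrac A).

(* h (h p) = p, written for a numerator q and a denominator d of h p, since h is
   not yet known to extend to fractions. *)
Definition inverted p :=
  exists d q, [/\ h d != 0, tofrac q = tofrac d * h p & h q = h d * tofrac p].

Lemma invertedD p p' : inverted p -> inverted p' -> inverted (p + p').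
Proof.
move=> [d [q [d0 e1 e2]]] [d' [q' [d0' e1' e2']]].
exists (d * d'), (q * d' + q' * d); split.
- by rewrite rmorphM mulf_neq0.
- by rewrite !rmorphD !rmorphM /= e1 e1'; ring.
- by rewrite !rmorphD !rmorphM /= e2 e2'; ring.
Qed.

Lemma invertedM p p' : inverted p -> inverted p' -> inverted (p * p').
Proof.
move=> [d [q [d0 e1 e2]]] [d' [q' [d0' e1' e2']]].
exists (d * d'), (q * q'); split.
- by rewrite rmorphM mulf_neq0.
- by rewrite !rmorphM /= e1 e1'; ring.
- by rewrite !rmorphM /= e2 e2'; ring.
Qed.

Lemma inverted_fixed p : h p = tofrac p -> inverted p.
Proof.
by move=> e; exists 1, p; rewrite !rmorph1 !mul1r e oner_neq0.
Qed.

Hypothesis inv : forall p, inverted p.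

(** [inverted] forces injectivity: h p = 0 gives q = 0, and then h d != 0 gives p = 0. So [h]
    extends, and it squares to the identity on numerators and denominators. *)
Lemma involution_extends : exists H : {rmorphism {fraction A} -> {fraction A}},
  (forall p, H (tofrac p) = h p) /\ involutive H.
Proof.
have h0 p : h p = 0 -> p = 0.
  have [d [q [d0 e1 e2]]] := inv p; move=> e; move: e1.
  rewrite e mulr0 => /eqP; rewrite tofrac_eq0 => /eqP q0.
  move/esym/eqP: e2; rewrite q0 rmorph0 mulf_eq0 (negPf d0) tofrac_eq0.
  exact/eqP.
have [H HE] := rmorphism_extends h0; exists H; split=> // x.
have HH p : H (h p) = tofrac p.
  have [d [q [d0 e1 e2]]] := inv p.
  by apply: (mulfI d0); rewrite -e2 -(HE q) e1 rmorphM HE.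
by rewrite [in LHS](fracE x) !fmorph_div !HE !HH -fracE.
Qed.
End InvolutionExtension.

(** * The involutions exchanging the variables of one colour *)

Section BipartiteAutomorphism.
Variables (R : realType) (Q Q' : bigraph).
Local Notation V := (box_vertex Q Q').
Local Notation C := (R[i]).
Local Notation A := {mpoly C[#|V|]}.
Local Notation K := (ratfield R V).
Local Notation X := (@ratvar R V).

Lemma rmorph_neighbours (F F' : fieldType) (phi : {rmorphism F -> F'}) (x : V -> F) v :
  phi (neighbours x v) = neighbours (fun y => phi (x y)) v.
Proof.
by rewrite rmorphD !rmorph_prod; congr (_ + _); apply: eq_bigr => i _; rewrite rmorphXn.
Qed.

Definition poly_neighbours v : A :=
  \prod_a 'X_(enum_rank ((a, v.2) : V)) ^+ mult v.1 a
  + \prod_j 'X_(enum_rank ((v.1, j) : V)) ^+ mult v.2 j.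

Lemma poly_neighboursE (L : fieldType) (phi : {rmorphism A -> L}) v :
  phi (poly_neighbours v) = neighbours (fun y => phi 'X_(enum_rank y)) v.
Proof.
by rewrite rmorphD !rmorph_prod; congr (_ + _); apply: eq_bigr => i _; rewrite rmorphXn.
Qed.

(** Setting all indeterminates to 1 gives 2, which is nonzero in C. *)
Lemma neighbours_neq0 v : neighbours X v != 0.
Proof.
rewrite -(poly_neighboursE (@tofrac A)) tofrac_eq0.
apply: contra_neq (_ : 2%:R != 0 :> C) => [e|]; last by rewrite Num.Theory.pnatr_eq0.
have := congr1 (meval (fun _ => 1)) e; rewrite meval0 => <-.
rewrite (poly_neighboursE (meval (fun=> 1))) /neighbours !big1 // => i _.
  by rewrite /= mevalXU expr1n.
by rewrite /= mevalXU expr1n.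
Qed.

Variable P : pred V.
Hypothesis P_indep : forall v y, P v -> black y = ~~ black v -> P y = false.

Definition flip v : K := if P v then neighbours X v / X v else X v.

Definition flip_morph : A -> K := mmap (@tofrac A \o @mpolyC _ C) (fun i => flip (enum_val i)).

HB.instance Definition _ := GRing.RMorphism.on flip_morph.

Lemma ratvar_neq0 v : X v != 0.
Proof.
rewrite tofrac_eq0; apply: contra_neq (oner_neq0 C) => e.
by have := congr1 (meval (fun=> 1)) e; rewrite mevalXU meval0.
Qed.

Lemma flip_morphC c : flip_morph c%:MP = ratconst V c.
Proof. exact: mmapC. Qed.

Lemma flip_morphX v : flip_morph 'X_(enum_rank v) = flip v.
Proof. by rewrite /flip_morph mmapX mmap1U enum_rankK. Qed.

Lemma flip_inverted p : inverted flip_morph p.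
Proof.
have var v : inverted flip_morph 'X_(enum_rank v).
  case: (boolP (P v)) => Pv; last first.
    by apply: inverted_fixed; rewrite /= flip_morphX /flip (negPf Pv).
  have q0 : neighbours X v / X v != 0.
    by rewrite mulf_neq0 ?invr_eq0 ?neighbours_neq0 ?ratvar_neq0.
  (* X_v times its image is the neighbour polynomial, whose variables have the opposite colour and
     are fixed. *)
  exists 'X_(enum_rank v), (poly_neighbours v).
  rewrite /= !flip_morphX (poly_neighboursE (@tofrac A)) (poly_neighboursE flip_morph).
  rewrite /flip Pv q0 -/(X v) mulrC divfK ?ratvar_neq0 //; split=> //.
  by apply: eq_neighbours => y yv; rewrite /= flip_morphX /flip (P_indep Pv yv).
have const c : inverted flip_morph c%:MP by apply: inverted_fixed; exact: flip_morphC.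
elim/mpolyind: p => [|c m p _ _ IH]; first by rewrite -mpolyC0; exact: const.
apply: invertedD => //; rewrite -mul_mpolyC mpolyXE_id.
apply: invertedM => //.
elim/big_ind: _ => [||i _]; [by rewrite -mpolyC1; exact: const|exact: invertedM|].
rewrite -(enum_valK i); elim: (m _) => [|k IHk]; first by rewrite expr0 -mpolyC1; exact: const.
by rewrite exprS; exact: invertedM.
Qed.

Lemma flip_involution : exists H : {rmorphism K -> K},
  [/\ forall c, H (ratconst V c) = ratconst V c, forall v, H (X v) = flip v
    & involutive H].
Proof.
have [H [HE HK]] := involution_extends flip_inverted.
exists H; split=> // [c|v]; rewrite HE; [exact: flip_morphC | exact: flip_morphX].
Qed.
End BipartiteAutomorphism.

Section Existence.
Variables (R : realType) (Q Q' : bigraph).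
Local Notation V := (box_vertex Q Q').

Lemma bipartite_mutation_exists : exists mu : automorphism (ratfield R V),
  is_bipartite_mutation mu.
Proof.
have [|Hb [cb vb Kb]] := @flip_involution R Q Q' (@black Q Q').
  by move=> v y /= bv ->; rewrite bv.
have [|Hw [cw vw Kw]] := @flip_involution R Q Q' (@white Q Q').
  by move=> v y /= wv e; rewrite /white /= e; exact: negbF.
have K1 : cancel (Hb \o Hw) (Hw \o Hb) by move=> x /=; rewrite Kb Kw.
have K2 : cancel (Hw \o Hb) (Hb \o Hw) by move=> x /=; rewrite Kw Kb.
(* [Hw] is applied first, so that [Hb] then replaces the black variables in the white exchange
   formula by their mutated values. *)
exists (Automorphism (aut := Hb \o Hw) K1 K2); split=> [c|v] /=; first by rewrite cw cb.
rewrite vw /flip /white /=; case: (boolP (black v)) => bv /=.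
  by rewrite vb /flip bv [RHS]mutated_black.
rewrite fmorph_div rmorph_neighbours [RHS]mutated_white // vb /flip (negPf bv).
congr (_ / _); apply: eq_neighbours => y; rewrite (negPf bv) => yb.
by rewrite vb /flip yb [RHS]mutated_black.
Qed.
End Existence.

(** * The octahedron recurrence *)

Section AutomorphismPowers.
Variables (F : fieldType) (mu : automorphism F).

Lemma aut_inv_rmorphism : exists phi : {rmorphism F -> F}, phi =1 aut_inv mu.
Proof.
have za : zmod_morphism (aut_inv mu) by exact: (can2_zmod_morphism (autK mu) (aut_invK mu)).
have mm : monoid_morphism (aut_inv mu) by exact: (can2_monoid_morphism (autK mu) (aut_invK mu)).
pose c1 := GRing.isZmodMorphism.Build F F (aut_inv mu) za.
pose c2 := GRing.isMonoidMorphism.Build F F (aut_inv mu) mm.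
pose phi : {rmorphism F -> F} := HB.pack (aut_inv mu) c1 c2.
by exists phi.
Qed.

(** Lets every power of [mu], negative ones included, act on the exchange relations. *)
Lemma autz_rmorphism k : exists phi : {rmorphism F -> F}, phi =1 autz mu k.
Proof.
have it (f : {rmorphism F -> F}) j : exists phi : {rmorphism F -> F}, phi =1 iter j f.
  elim: j => [|j [phi e]]; first by exists idfun.
  by exists (f \o phi) => x /=; rewrite e.
have [inv ie] := aut_inv_rmorphism.
case: k => j; first exact: it.
have [phi e] := it inv j.+1; exists phi => x; rewrite e.
exact: eq_iter.
Qed.

Lemma autzS k x : autz mu (k + 1) x = autz mu k (mu x).
Proof.
case: k => [j|[|j]].
- have -> : Posz j + 1 = Posz j.+1 by lia.
  exact: iterSr.
- by rewrite /= autK.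
have -> : Negz j.+1 + 1 = Negz j by lia.
by rewrite /autz (iterSr j.+1) autK.
Qed.
End AutomorphismPowers.

(** * The orbits of the initial variables as minors of one array *)

Section Octahedron.
Variables (R : realType) (m n' : nat).
Local Notation n := n'.+1.
Local Notation G := (path_graph m).
Local Notation Y := (cycle_graph n).
Local Notation V := (box_vertex G Y).
Local Notation F := (ratfield R V).
Local Notation X := (@ratvar R V).
Variable mu : automorphism F.
Hypothesis mu_mut : is_bipartite_mutation mu.

Definition orbit_var (k : int) (v : V) : F := autz mu k (X v).

Lemma orbit_var_neq0 k v : orbit_var k v != 0.
Proof.
have [phi e] := autz_rmorphism mu k.
by rewrite /orbit_var -e fmorph_eq0 ratvar_neq0.
Qed.

Lemma orbit_exchange k v : orbit_var (k + 1) v * orbit_var k v =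
  neighbours (orbit_var (if black v then k else k + 1)) v.
Proof.
have [phi e] := autz_rmorphism mu k; have [_ muX] := mu_mut.
have XE y : orbit_var k y = phi (X y) by rewrite e.
have XSE y : orbit_var (k + 1) y = phi (seed_var (mutated_seed R G Y) y).
  by rewrite /orbit_var autzS -e muX.
have nz : phi (X v) != 0 by rewrite -XE orbit_var_neq0.
rewrite XSE XE; case: ifPn => bv.
  rewrite [seed_var _ _]mutated_black // fmorph_div divfK // rmorph_neighbours.
  by apply: eq_neighbours => y _; rewrite XE.
rewrite [seed_var _ _]mutated_white // fmorph_div divfK // rmorph_neighbours.
by apply: eq_neighbours => y _; rewrite XSE.
Qed.

Definition modc (j : int) : nat := `|(j %% (2 * n)%:Z)%Z|%N.

Lemma modc_lt j : (modc j < 2 * n)%N.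
Proof. by rewrite /modc; lia. Qed.

Definition ordc j : 'I_(2 * n) := Ordinal (modc_lt j).

Lemma modcE j : (modc j)%:Z = (j %% (2 * n)%:Z)%Z.
Proof. by rewrite /modc; lia. Qed.

Lemma modc_eq i j : (modc i == modc j) = ((2 * n)%:Z %| i - j)%Z.
Proof. by rewrite -eqz_mod_dvd -!modcE. Qed.

Lemma modc_nat (c : nat) : (c < 2 * n)%N -> modc c = c.
Proof. by move=> h; rewrite /modc modz_nat modn_small. Qed.

Lemma modc_mod (c : nat) : (c %% (2 * n))%N = modc c.
Proof. by rewrite /modc modz_nat. Qed.

Lemma odd_modc j : odd (modc j) = odd `|j|.
Proof.
have := divz_eq j (2 * n)%:Z; rewrite -modcE.
have -> : (j %/ (2 * n)%:Z)%Z * (2 * n)%:Z = 2 * ((j %/ (2 * n)%:Z)%Z * n%:Z) by lia.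
by move: (_ * n%:Z) (modc j) => q c; lia.
Qed.

(* The rows 0 and m + 1 are the boundary, where the variables are 1; the row
   [a.+1] belongs to the vertex [a] of the path. *)
Definition row_var (s : nat) (j k : int) : F :=
  if s is a.+1 then oapp (fun a : 'I_m => orbit_var k (a, ordc j)) 1 (insub a) else 1.

(** The empty product for [c] out of range matches the boundary value 1 of [row_var]. *)
Lemma prod_delta N (x : 'I_N -> F) c :
  \prod_i x i ^+ (c == i :> nat) = oapp x 1 (insub c).
Proof.
case: insubP => [u _ <-|cN] /=.
  rewrite (bigD1 u) //= eqxx big1 ?mulr1 // => i.
  by rewrite eq_sym -(inj_eq val_inj) => /negPf ->.
rewrite big1 // => i _; case: eqP => // e.
by rewrite e ltn_ord in cN.
Qed.

(** Splitting the exponents separates the two neighbours in each direction. For n = 1 the residues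
    of j+1 and j-1 agree, and the product is the square due to the double edge. *)
Lemma neighbours_rows k (a : 'I_m) j :
  neighbours (orbit_var k) ((a, ordc j) : V) =
  row_var a.+2 j k * row_var a j k + row_var a.+1 (j + 1) k * row_var a.+1 (j - 1) k.
Proof.
rewrite /neighbours /= /path_mult /cycle_mult; congr (_ + _).
  rewrite (eq_bigr _ (fun i _ => exprD _ _ _)) big_split /=; congr (_ * _).
    exact: (prod_delta (fun i => orbit_var k (i, ordc j))).
  case: (a : nat) => [|a'] /=; first by rewrite big1.
  rewrite -(prod_delta (fun i => orbit_var k (i, ordc j))).
  by apply: eq_bigr => i _; rewrite eqSS eq_sym.
rewrite (eq_bigr _ (fun i _ => exprD _ _ _)) big_split /= valK /=.
have e j' : orbit_var k (a, ordc j') =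
    \prod_(i < 2 * n) orbit_var k (a, i) ^+ (modc j' == i :> nat).
  rewrite (prod_delta (fun i => orbit_var k (a, i))) insubT //=; first exact: modc_lt.
  by move=> h; congr (orbit_var k (a, _)); apply: val_inj.
rewrite !e; congr (_ * _); apply: eq_bigr => i _; congr (_ ^+ _); congr nat_of_bool.
  rewrite modc_mod; congr (_ == _); apply/eqP; rewrite modc_eq.
  rewrite -addn1 PoszD opprD addrACA subrr addr0 -modc_eq modc_nat //.
  exact: modc_lt.
rewrite modc_mod modc_eq -[in RHS](modc_nat (ltn_ord i)) eq_sym modc_eq.
by congr (_ %| _)%Z; lia.
Qed.

Lemma row_var_neq0 s j k : row_var s j k != 0.
Proof.
case: s => [|a] /=; first exact: oner_neq0.
by case: insub => [a'|] /=; [exact: orbit_var_neq0 | exact: oner_neq0].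
Qed.

(* Light-cone coordinates: the window with corner (a, b) and size s ends at the
   time a + b + s - 1; even times are those of the black vertices. *)
Definition octa (s : nat) (a b : int) : F :=
  row_var s (a - b) ((a + b + s%:Z - 1) %/ 2)%Z.

Lemma octa_neq0 s a b : octa s a b != 0.
Proof. exact: row_var_neq0. Qed.

Lemma octa0 a b : octa 0 a b = 1. Proof. by []. Qed.

Lemma octa_last a b : octa m.+1 a b = 1.
Proof. by rewrite /octa /= insubF ?ltnn. Qed.

(** The exchange relation at the path vertex s, which lies in row s+1. The four neighbours share the
    time (a+b+s+1)/2 rounded down: k at a black vertex, where a+b+s is even, and k+1 at a white
    one. *)
Lemma octahedron s a b : (s < m)%N ->
  octa s.+1 a b * octa s.+1 (a + 1) (b + 1) =
  octa s.+1 (a + 1) b * octa s.+1 a (b + 1) + octa s.+2 a b * octa s (a + 1) (b + 1).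
Proof.
move=> sm; pose v := Ordinal sm; pose j := a - b.
pose k := ((a + b + s%:Z) %/ 2)%Z.
pose k' := if black ((v, ordc j) : V) then k else k + 1.
have bE : black ((v, ordc j) : V) = ~~ odd `|a + b + s%:Z|.
  by rewrite /black /= odd_modc /j; lia.
have k'E : k' = ((a + b + s%:Z + 1) %/ 2)%Z.
  by rewrite /k' bE /k; case: ifP => h; lia.
have := orbit_exchange k (v, ordc j); rewrite -/k' neighbours_rows mulrC; move=> e.
have rowE j' kk : row_var s.+1 j' kk = orbit_var kk (v, ordc j').
  by rewrite /= (insubT (fun i => i < m)%N sm).
have -> : octa s.+1 a b = orbit_var k (v, ordc j).
  by rewrite /octa rowE /k; congr (orbit_var _ _); lia.
have -> : octa s.+1 (a + 1) (b + 1) = orbit_var (k + 1) (v, ordc j).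
  by rewrite /octa rowE /k /j; congr (orbit_var _ (_, ordc _)); lia.
rewrite e addrC /octa k'E /j.
congr (row_var _ _ _ * row_var _ _ _ + row_var _ _ _ * row_var _ _ _); lia.
Qed.

Local Notation w := (octa 1).

(** Both sides obey the same recurrence in [s], the octahedron relation being Dodgson's identity,
    and the interior minor to divide by is a nonzero cluster variable or 1. *)
Lemma octa_minor s a b : (s <= m.+1)%N -> octa s a b = wminor w s a b.
Proof.
elim/ltn_ind: s a b => -[|[|s]] IH a b sm.
- by rewrite octa0 /wminor minor0.
- by rewrite /wminor minor1 !addr0.
have h c d : octa s c d = wminor w s c d by apply: IH => //; lia.
have h1 c d : octa s.+1 c d = wminor w s.+1 c d by apply: IH => //; lia.
have nz := octa_neq0 s (a + 1) (b + 1).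
apply: (mulIf nz); rewrite [in RHS]h wminor_dodgson -?h // -!h1.
by rewrite octahedron //; ring.
Qed.

Lemma minor_last a b : wminor w m.+1 a b = 1.
Proof. by rewrite -octa_minor // octa_last. Qed.

(** One more Dodgson step: the four (m+1)-minors are 1, so the right side is 1 - 1. *)
Lemma minor_vanish a b : wminor w m.+2 a b = 0.
Proof.
have nz : wminor w m (a + 1) (b + 1) != 0 by rewrite -octa_minor // octa_neq0.
by apply: (mulIf nz); rewrite wminor_dodgson // !minor_last subrr mul0r.
Qed.

(** The position a-b makes a full turn of the cycle, while the time depends on a+b only. *)
Lemma octa_periodic s a b : octa s (a + n%:Z) (b - n%:Z) = octa s a b.
Proof.
have -> : octa s (a + n%:Z) (b - n%:Z) =
    row_var s (a - b + (2 * n)%:Z) ((a + b + s%:Z - 1) %/ 2)%Z.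
  by congr row_var; [lia | congr (_ %/ _)%Z; lia].
have e j : ordc (j + (2 * n)%:Z) = ordc j by apply: val_inj; rewrite /= /modc modzDr.
by rewrite /octa; case: s => //= s; rewrite e.
Qed.

Lemma orbit_linearizable v : linearizable (fun k => orbit_var k v).
Proof.
(* [a0] is (j-a)/2 rounded up: the window of size a+1 with corner (a0, a0-j) then ends at time 0 or
   1, both of which give k = 0. *)
case: v => a j; pose a0 := ((j%:Z - a%:Z + 1) %/ 2)%Z.
have oE k : orbit_var k (a, j) = wminor w a.+1 (a0 + k) (a0 - j%:Z + k).
  rewrite -octa_minor; last by rewrite ltnS; exact: ltnW (ltn_ord a).
  rewrite /octa /= valK /=.
  have -> : ordc (a0 + k - (a0 - j%:Z + k)) = j.
    by apply: val_inj; rewrite /= -[RHS](modc_nat (ltn_ord j)); congr modc; lia.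
  by congr (orbit_var _ _); rewrite /a0; lia.
(* The array has rank m+1 and period n, the successor of n'. *)
have [|||r [c cE]] := @linearizable_wminor _ w m n' _ _ _ a.+1 a0 (a0 - j%:Z).
- by move=> a' b'; rewrite minor_last oner_neq0.
- exact: minor_vanish.
- exact: octa_periodic.
exists r, c => k; rewrite oE cE; apply: eq_bigr => i _.
by rewrite oE.
Qed.
End Octahedron.

Theorem mainTheorem1 (R : realType) (m n : nat) (hm : (1 <= m)%N)
    (hn : (1 <= n)%N) :
  (exists mu : automorphism
       (ratfield R (box_vertex (path_graph m) (cycle_graph n))),
     is_bipartite_mutation mu) /\
  (forall mu : automorphism
       (ratfield R (box_vertex (path_graph m) (cycle_graph n))),
     is_bipartite_mutation mu ->
     forall v : box_vertex (path_graph m) (cycle_graph n),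
       linearizable_at mu (ratvar R v)).
Proof.
split; first exact: bipartite_mutation_exists.
case: n hn => // n _ mu mu_mut v; exact: orbit_linearizable.
Qed.
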